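(* Let $p\in(1,2]$ and let $X,E$ be Banach spaces. Then $\mathcal{T}_p\circ\mathrm{Lip}_0(X,E)\subseteq\mathcal{T}_p^{\mathrm{Lip}_0}(X,E)$ and $\|f\|_{\mathcal{T}_p^{\mathrm{Lip}}}\le\|f\|_{\mathcal{T}_p\circ\mathrm{Lip}_0}$ for all $f\in\mathcal{T}_p\circ\mathrm{Lip}_0(X,E)$.
   Context: For Banach spaces $X,E$, $\mathrm{Lip}_0(X,E)$ is the Banach space of Lipschitz maps $f:X\to E$ with $f(0)=0$, normed by $\mathrm{Lip}(f)=\sup_{x\ne y}\|f(x)-f(y)\|/\|x-y\|$. $(r_n)_{n\in\mathbb{N}}$ are the Rademacher functions on $[0,1]$. A bounded linear operator $T:F\to E$ between Banach spaces has Rademacher type $p$ if there is $C>0$ with $\left(\int_0^1\|\sum_{k=1}^N r_k(t)T(x_k)\|_E^2dt\right)^{1/2}\le C\left(\sum_{k=1}^N\|x_k\|_F^p\right)^{1/p}$ for all $N\in\mathbb{N}$ and $(x_1,\ldots,x_N)\in F^N$; $\mathcal{T}_p(F,E)$ is the set of such $T$ and $\|T\|_{\mathcal{T}_p}$ is the infimum of such $C$. $\mathcal{T}_p\circ\mathrm{Lip}_0(X,E)$ is the set of $f\in\mathrm{Lip}_0(X,E)$ for which there exist a Banach space $F$, $h\in\mathrm{Lip}_0(X,F)$ and $S\in\mathcal{T}_p(F,E)$ with $f=S\circ h$; $\|f\|_{\mathcal{T}_p\circ\mathrm{Lip}_0}=\inf\{\|S\|_{\mathcal{T}_p}\mathrm{Lip}(h)\}$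 over all such factorizations. $f\in\mathrm{Lip}_0(X,E)$ has type $p$ if there is $C>0$ such that for all $N\in\mathbb{N}$, $(\lambda_1,\ldots,\lambda_N)\in\mathbb{R}^N$ and $(x_1,\ldots,x_N),(y_1,\ldots,y_N)\in X^N$, $$\left(\int_0^1\Big\|\sum_{k=1}^N\lambda_k r_k(t)(f(x_k)-f(y_k))\Big\|_E^2dt\right)^{1/2}\le C\left(\sum_{k=1}^N|\lambda_k|^p\|x_k-y_k\|_X^p\right)^{1/p}.$$ The set of such $f$ is $\mathcal{T}_p^{\mathrm{Lip}_0}(X,E)$ and $\|f\|_{\mathcal{T}_p^{\mathrm{Lip}}}$ is the infimum of all such $C$. *)

(* Defs.v *)
From HB Require Import structures.
From mathcomp Require Import all_boot all_order all_algebra.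
From mathcomp Require Import all_classical all_reals all_analysis.

Set Implicit Arguments.
Unset Strict Implicit.
Unset Printing Implicit Defensive.
Import Order.TTheory GRing.Theory Num.Theory.
Import numFieldNormedType.Exports.
Local Open Scope classical_set_scope.
Local Open Scope ring_scope.

(* r_n(t) = sgn (sin (2^n pi t)); the Rademacher system is (r_n)_{n >= 1}
   (r_0 is constantly 1 on ]0, 1[). *)
Definition rademacher (R : realType) (n : nat) (t : R) : R :=
  Num.sg (sin (2 ^+ n * pi * t)).

(* (int_0^1 |r_1(t) v_1 + ... + r_N(t) v_N|^2 dt)^(1/2); the index k : 'I_N
   starts at 0, whence r_(k+1). *)
Definition rademacher_avg (R : realType) (E : normedModType R) (N : nat)
    (v : 'I_N -> E) : R :=
  Num.sqrt (\int[@lebesgue_measure R]_(t in `[0%R, 1%R])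
    (`| \sum_(k < N) rademacher k.+1 t *: v k | ^+ 2)).

Definition Lip0 (R : realType) (X E : completeNormedModType R) :
    set (X -> E) :=
  [set f | lipschitz f /\ f 0 = 0].

Definition Lip (R : realType) (X E : completeNormedModType R) (f : X -> E) : R :=
  sup [set `|f z.1 - f z.2| / `|z.1 - z.2| | z in [set z : X * X | z.1 <> z.2]].

Definition type_const (R : realType) (p : R) (F E : completeNormedModType R)
    (T : F -> E) : set R :=
  [set C | 0 < C /\ forall (N : nat) (x : 'I_N -> F),
     rademacher_avg (fun k => T (x k))
       <= C * (\sum_(k < N) `|x k| `^ p) `^ p^-1].

Definition type_op (R : realType) (p : R) (F E : completeNormedModType R) :
    set {linear F -> E} :=
  [set T | (exists M : R, forall x, `|T x| <= M * `|x|)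
           /\ type_const p T !=set0].

Definition type_op_norm (R : realType) (p : R) (F E : completeNormedModType R)
    (T : {linear F -> E}) : R :=
  inf (type_const p T).

Definition type_Lip0_factor (R : realType) (p : R)
    (X E F : completeNormedModType R) (f : X -> E)
    (h : X -> F) (S : {linear F -> E}) : Prop :=
  [/\ Lip0 h, type_op p S & f = S \o h].

Definition type_comp_Lip0 (R : realType) (p : R)
    (X E : completeNormedModType R) : set (X -> E) :=
  [set f | Lip0 f /\
     exists (F : completeNormedModType R) (h : X -> F) (S : {linear F -> E}),
       type_Lip0_factor p f h S].

Definition type_comp_Lip0_norm (R : realType) (p : R)
    (X E : completeNormedModType R) (f : X -> E) : R :=
  inf [set c | exists (F : completeNormedModType R) (h : X -> F)
                 (S : {linear F -> E}),
                 type_Lip0_factor p f h S /\ c = type_op_norm p S * Lip h].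

Definition type_Lip_const (R : realType) (p : R)
    (X E : completeNormedModType R) (f : X -> E) : set R :=
  [set C | 0 < C /\ forall (N : nat) (lambda : 'I_N -> R) (x y : 'I_N -> X),
     rademacher_avg (fun k => lambda k *: (f (x k) - f (y k)))
       <= C * (\sum_(k < N) `|lambda k| `^ p * `|x k - y k| `^ p) `^ p^-1].

Definition type_Lip0 (R : realType) (p : R) (X E : completeNormedModType R) :
    set (X -> E) :=
  [set f | Lip0 f /\ type_Lip_const p f !=set0].

Definition type_Lip_norm (R : realType) (p : R)
    (X E : completeNormedModType R) (f : X -> E) : R :=
  inf (type_Lip_const p f).

(* Main.v *)
(** If [f = S \o h], linearity gives
    [lambda_k (f x_k - f y_k) = S (lambda_k (h x_k - h y_k))], so the type
    inequality of [S] at the vectors [lambda_k (h x_k - h y_k)], whose norms are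
    at most [Lip h |lambda_k| |x_k - y_k|], is the Lipschitz type inequality of
    [f] with constant [C * Lip h]. Admissible constants have to be positive while
    [Lip h] may vanish, hence the slack [e] in the constant [C * Lip h + e]. *)
Require Import Defs.
From mathcomp Require Import all_boot all_order all_algebra.
From mathcomp Require Import all_classical all_reals all_analysis.
Import Order.TTheory GRing.Theory Num.Theory.
Import numFieldNormedType.Exports.
Local Open Scope classical_set_scope.
Local Open Scope ring_scope.

Lemma Lip_ge0 (R : realType) (X E : completeNormedModType R) (h : X -> E) :
  0 <= Lip h.
Proof.
rewrite /Lip; set A := [set _ | _ in _].
(* [sup] is 0 by convention when the quotients are unbounded or there are none, as for trivial [X];
   otherwise any quotient bounds it from below. *)
have [supA|/sup_out->//] := pselect (has_sup A).
have [a Aa] := supA.1.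
apply: le_trans (ub_le_sup supA.2 Aa).
by case: Aa => z _ <-; rewrite divr_ge0.
Qed.

Lemma le_Lip (R : realType) (X E : completeNormedModType R) (h : X -> E) :
  lipschitz h -> forall x y, `|h x - h y| <= Lip h * `|x - y|.
Proof.
move=> [M [_ hM]] x y.
have [->|/eqP xy] := eqVneq x y; first by rewrite !subrr !normr0 mulr0.
have xy_gt0 : 0 < `|x - y| by rewrite normr_gt0 subr_eq0; apply/eqP.
rewrite -ler_pdivrMr//; apply: ub_le_sup; last by exists (x, y).
(* [lipschitz] is a statement near [+oo]: the estimate is available only for constants strictly
   above [M]. *)
exists (M + 1) => _ [[u v] /= uv <-].
rewrite ler_pdivrMr; last by rewrite normr_gt0 subr_eq0; apply/eqP.
by apply: (hM (M + 1) _ (u, v)) => //; rewrite ltrDl.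
Qed.

Lemma type_const_scale (R : realType) (p : R) (X E F : completeNormedModType R)
    (h : X -> F) (S : {linear F -> E}) (L C e : R) :
  0 < p -> 0 <= L -> (forall x y, `|h x - h y| <= L * `|x - y|) ->
  type_const p S C -> 0 < e -> type_Lip_const p (S \o h) (C * L + e).
Proof.
move=> p_gt0 L_ge0 hL [C_gt0 SC] e_gt0; split=> [|N lambda x y].
  by rewrite ltr_wpDl// mulr_ge0// ltW.
under [X in rademacher_avg X]eq_fun do rewrite /= -linearB -linearZ.
apply: le_trans (SC N _) _.
have T_ge0 : 0 <= \sum_(k < N) `|lambda k| `^ p * `|x k - y k| `^ p.
  by apply: sumr_ge0 => k _; rewrite mulr_ge0 ?powR_ge0.
rewrite mulrDl -[leLHS]addr0 lerD//; last first.
  by rewrite mulr_ge0 ?powR_ge0// ltW.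
rewrite -mulrA ler_wpM2l ?(ltW C_gt0)//.
have {1}-> : L = (L `^ p) `^ p^-1 by rewrite -powRrM mulfV ?gt_eqF// powRr1.
rewrite -powRM ?powR_ge0//.
apply: ge0_ler_powR; rewrite ?nnegrE ?invr_ge0 ?(ltW p_gt0)//.
- by apply: sumr_ge0 => k _; rewrite powR_ge0.
- by rewrite mulr_ge0 ?powR_ge0.
rewrite mulr_sumr; apply: ler_sum => k _.
rewrite -!powRM ?mulr_ge0//.
apply: ge0_ler_powR; rewrite ?nnegrE ?mulr_ge0 ?(ltW p_gt0)//.
by rewrite normrZ mulrCA ler_wpM2l.
Qed.

Lemma type_Lip_norm_le (R : realType) (p : R) (X E : completeNormedModType R)
    (f : X -> E) (C : R) :
  type_Lip_const p f C -> type_Lip_norm p f <= C.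
Proof. by apply: ge_inf; exists 0 => c [/ltW]. Qed.

Lemma type_Lip_norm_comp (R : realType) (p : R) (X E F : completeNormedModType R)
    (f : X -> E) (h : X -> F) (S : {linear F -> E}) :
  0 < p -> type_Lip0_factor p f h S ->
  type_Lip_norm p f <= type_op_norm p S * Lip h.
Proof.
move=> p_gt0 [[h_lip _] [_ S0] ->].
have le_CL C : type_const p S C -> type_Lip_norm p (S \o h) <= C * Lip h.
  move=> SC; apply/ler_addgt0Pr => e e_gt0; apply: type_Lip_norm_le.
  by apply: type_const_scale => //; [exact: Lip_ge0 | exact: le_Lip].
(* If [Lip h] is 0, a single type constant gives the bound 0; otherwise dividing by [Lip h] leaves a
   lower bound of all type constants, hence of their infimum. *)
have [L0|L_neq0] := eqVneq (Lip h) 0.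
  have [C /le_CL] := S0.
  by rewrite L0 !mulr0.
have L_gt0 : 0 < Lip h by rewrite lt0r L_neq0 Lip_ge0.
rewrite -ler_pdivrMr//; apply: lb_le_inf => // C /le_CL.
by rewrite ler_pdivrMr.
Qed.

Theorem proposition3p10 (R : realType) (p : R) (hp : 1 < p <= 2)
    (X E : completeNormedModType R) :
  @type_comp_Lip0 R p X E `<=` @type_Lip0 R p X E /\
  (forall f : X -> E, type_comp_Lip0 p f ->
     type_Lip_norm p f <= type_comp_Lip0_norm p f).
Proof.
have p_gt0 : 0 < p by case/andP: hp => /(lt_trans ltr01).
split=> f [f_lip [F [h [S fhS]]]].
  split=> //; case: fhS => -[h_lip _] [_ [C SC]] ->.
  exists (C * Lip h + 1).
  by apply: type_const_scale => //; [exact: Lip_ge0 | exact: le_Lip].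
(* The given factorization makes the set nonempty; the infimum of an empty set would be 0 by
   convention. *)
apply: lb_le_inf; first by exists (type_op_norm p S * Lip h), F, h, S.
by move=> _ [G [g [T [fgT ->]]]]; exact: type_Lip_norm_comp.
Qed.
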